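(* As $n\to\infty$, $H_{F_n} \sim n\ln(\alpha)$. More precisely, $H_{F_n} = n\ln(\alpha) + O(1)$.
   Context: $F_n$ ($n\ge1$) are the Fibonacci numbers: $F_1=F_2=1$, $F_n=F_{n-1}+F_{n-2}$ for $n\ge3$. $\alpha = \frac{1+\sqrt5}{2}$ is the golden ratio. $H_k=\sum_{i=1}^k\frac1i$ is the $k$-th harmonic number. $a_n\sim b_n$ means $a_n/b_n\to1$. *)

(* Defs.v *)
From HB Require Import structures.
From mathcomp Require Import all_boot all_order all_algebra.
From mathcomp Require Import all_classical all_reals all_analysis.

Set Implicit Arguments.
Unset Strict Implicit.
Unset Printing Implicit Defensive.

Import Order.TTheory GRing.Theory Num.Theory.
Import numFieldNormedType.Exports.

Local Open Scope ring_scope.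

(* The sequence of interest starts at index 1; fib 0 = 0 is the usual
   backward extension of the recurrence. *)
Fixpoint fib (n : nat) : nat :=
  match n with
  | 0 => 0
  | m.+1 => match m with
            | 0 => 1
            | k.+1 => fib m + fib k
            end
  end%N.

Definition golden_ratio (R : realType) : R := (1 + Num.sqrt 5) / 2.

(* [harmonic i] is 1 / (i + 1) and [series u k] sums u over 0 <= i < k, so this
   is 1 + 1/2 + ... + 1/k. *)
Definition harmonic_number (R : realType) (k : nat) : R :=
  series (@harmonic R) k.

(* Main.v *)
Require Import Defs.
From HB Require Import structures.
From mathcomp Require Import all_boot all_order all_algebra.
From mathcomp Require Import all_classical all_reals all_analysis.
From mathcomp Require Import ring lra.

Set Implicit Arguments.
Unset Strict Implicit.
Unset Printing Implicit Defensive.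

Import Order.TTheory GRing.Theory Num.Theory.
Import numFieldNormedType.Exports.

Local Open Scope classical_set_scope.
Local Open Scope ring_scope.

(** The harmonic numbers are logarithmic up to a bounded error,
    [ln k <= H_k <= 1 + ln k] ([ln_le_harmonic_number],
    [harmonic_number_le_ln]), and the Fibonacci numbers are powers of the
    golden ratio [a] up to a bounded factor, [a ^ (n - 2) <= F_n <= a ^ (n - 1)]
    ([expr_golden_ratio_le_fib], [fib_le_expr_golden_ratio]).  Since the
    logarithm turns a bounded factor into a bounded error, composing the two
    gives [`|H_(F_n) - n * ln a| <= 1 + 2 * ln a] for [n >= 2].  The asymptotic
    equivalence follows from this estimate because [n * ln a] tends to infinity
    ([cvg_div_linear]). *)

Lemma golden_ratio_gt1 (R : realType) : 1 < golden_ratio R.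
Proof.
have : Num.sqrt 1 < Num.sqrt 5 :> R by rewrite ltr_sqrt; lra.
by rewrite sqrtr1 /golden_ratio => ?; lra.
Qed.

Lemma golden_ratio_sqr (R : realType) :
  golden_ratio R ^+ 2 = golden_ratio R + 1.
Proof.
have s5 : Num.sqrt 5 ^+ 2 = 5 :> R by rewrite sqr_sqrtr.
rewrite /golden_ratio; set s := Num.sqrt 5 in s5 *.
have -> : ((1 + s) / 2) ^+ 2 = (1 + 2 * s + s ^+ 2) / 4 by field.
by rewrite s5; field.
Qed.

(** Powers of a root of [x ^ 2 = x + 1] satisfy the Fibonacci recurrence, which
    is what lets both comparisons below propagate from two initial values. *)
Lemma golden_ratio_exprSS (R : realType) (n : nat) :
  golden_ratio R ^+ n.+2 = golden_ratio R ^+ n.+1 + golden_ratio R ^+ n.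
Proof. by rewrite -addn2 exprD golden_ratio_sqr mulrDr mulr1 -exprSr. Qed.

Lemma fibSS (n : nat) : fib n.+2 = (fib n.+1 + fib n)%N.
Proof. by []. Qed.

Lemma fib_gt0 (n : nat) : (0 < fib n.+1)%N.
Proof. by elim: n => // n IHn; rewrite fibSS addn_gt0 IHn. Qed.

Lemma fib_le_expr_golden_ratio (R : realType) (n : nat) :
  (fib n.+1)%:R <= golden_ratio R ^+ n.
Proof.
have a1 := golden_ratio_gt1 R.
suff [] : (fib n.+1)%:R <= golden_ratio R ^+ n /\
          (fib n.+2)%:R <= golden_ratio R ^+ n.+1 by [].
elim: n => [|n [IH1 IH2]]; first by rewrite expr0 expr1; split => //; exact: ltW.
by split => //; rewrite fibSS natrD golden_ratio_exprSS lerD.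
Qed.

Lemma expr_golden_ratio_le_fib (R : realType) (n : nat) :
  golden_ratio R ^+ n <= (fib n.+2)%:R.
Proof.
have a1 := golden_ratio_gt1 R; have a2 := golden_ratio_sqr R.
suff [] : golden_ratio R ^+ n <= (fib n.+2)%:R /\
          golden_ratio R ^+ n.+1 <= (fib n.+3)%:R by [].
elim: n => [|n [IH1 IH2]].
  rewrite expr0 expr1; split => //.
  (* were a > 2, then a ^ 2 > 2 a > a + 1 *)
  by change ((fib 3)%:R : R) with (2 : R); nra.
by split => //; rewrite fibSS natrD golden_ratio_exprSS lerD.
Qed.

Lemma harmonic_numberS (R : realType) (k : nat) :
  harmonic_number R k.+1 = harmonic_number R k + k.+1%:R^-1.
Proof. by rewrite /harmonic_number /series /= big_nat_recr. Qed.

Lemma ln_succ_sub_le (R : realType) (k : nat) :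
  ln k.+2%:R - ln k.+1%:R <= k.+1%:R^-1 :> R.
Proof.
have k0 : 0 < k.+1%:R :> R by rewrite ltr0n.
rewrite -ln_div ?posrE ?ltr0n//.
have -> : k.+2%:R / k.+1%:R = 1 + k.+1%:R^-1 :> R.
  by rewrite -[k.+2]addn1 natrD mulrDl divff ?gt_eqF// mul1r.
by apply: le_ln1Dx; rewrite (lt_trans (ltrN10 _))// invr_gt0.
Qed.

Lemma inv_le_ln_succ_sub (R : realType) (k : nat) :
  k.+2%:R^-1 <= ln k.+2%:R - ln k.+1%:R :> R.
Proof.
have k2 : 0 < k.+2%:R :> R by rewrite ltr0n.
rewrite -[leRHS]opprB lerNr -ln_div ?posrE ?ltr0n//.
have -> : k.+1%:R / k.+2%:R = 1 + - k.+2%:R^-1 :> R.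
  have -> : k.+1%:R = k.+2%:R - 1 :> R by rewrite -[k.+2]addn1 natrD addrK.
  by rewrite mulrBl divff ?gt_eqF// mul1r.
by apply: le_ln1Dx; rewrite ltrN2 invf_lt1// ltr1n.
Qed.

(** The bound at [k + 1] rather than [k] is the one that telescopes: each term
    [1 / (k + 1)] dominates [ln (k + 2) - ln (k + 1)]. *)
Lemma ln_succ_le_harmonic_number (R : realType) (k : nat) :
  ln k.+1%:R <= harmonic_number R k.
Proof.
elim: k => [|k IHk]; first by rewrite ln1 /harmonic_number /series /= big_geq.
rewrite harmonic_numberS -lerBlDl.
by apply: le_trans (ln_succ_sub_le R k); rewrite lerB.
Qed.

Lemma ln_le_harmonic_number (R : realType) (k : nat) :
  (0 < k)%N -> ln k%:R <= harmonic_number R k.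
Proof.
move=> k0; apply: le_trans (ln_succ_le_harmonic_number R k).
by rewrite ler_ln ?posrE ?ltr0n// ler_nat.
Qed.

Lemma harmonic_number_le_ln (R : realType) (k : nat) :
  (0 < k)%N -> harmonic_number R k <= 1 + ln k%:R.
Proof.
case: k => // k _; elim: k => [|k IHk].
  by rewrite harmonic_numberS /harmonic_number /series /= big_geq// ln1 invr1; lra.
rewrite harmonic_numberS -(subrK (ln k.+1%:R) (ln k.+2%:R)) addrCA addrC.
by rewrite lerD// inv_le_ln_succ_sub.
Qed.

Lemma harmonic_number_fib_dist_le (R : realType) (n : nat) :
  (2 <= n)%N ->
  `|harmonic_number R (fib n) - n%:R * ln (golden_ratio R)|
    <= 1 + 2 * ln (golden_ratio R).
Proof.
case: n => [|[|n]]// _.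
have a1 := golden_ratio_gt1 R; have L0 := ln_gt0 a1.
have a0 : 0 < golden_ratio R by lra.
have F0 : 0 < (fib n.+2)%:R :> R by rewrite ltr0n fib_gt0.
have lo : n%:R * ln (golden_ratio R) <= ln (fib n.+2)%:R.
  rewrite mulr_natl -lnXn// ler_ln ?posrE ?exprn_gt0//.
  exact: expr_golden_ratio_le_fib.
have hi : ln (fib n.+2)%:R <= (n%:R + 1) * ln (golden_ratio R).
  rewrite natr1 mulr_natl -lnXn// ler_ln ?posrE ?exprn_gt0//.
  exact: fib_le_expr_golden_ratio.
have Hlo := ln_le_harmonic_number R (fib_gt0 n.+1).
have Hhi := harmonic_number_le_ln R (fib_gt0 n.+1).
rewrite -[n.+2]addn2 natrD in Hlo Hhi lo hi *.
by rewrite ler_norml; apply/andP; split; lra.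
Qed.

(** The relative error is at most [C / (n * L)], hence vanishes. *)
Lemma cvg_div_linear (R : realType) (u : nat -> R) (L C : R) :
  0 < L -> (\forall n \near \oo, `|u n - n%:R * L| <= C) ->
  (fun n : nat => u n / (n%:R * L)) @ \oo --> (1 : R).
Proof.
move=> L0 uC; apply/cvgrPdist_le => e e0; near=> n.
have n0 : 0 < n%:R :> R by rewrite ltr0n; near: n; exact: nbhs_infty_gt.
have nL0 : 0 < n%:R * L by rewrite mulr_gt0.
rewrite -[X in X - _](divff (lt0r_neq0 nL0)) -mulrBl normrM distrC.
rewrite [`|_^-1|]gtr0_norm ?invr_gt0// ler_pdivrMr//.
apply: (@le_trans _ _ C); first by near: n.
rewrite mulrCA -ler_pdivrMr ?mulr_gt0//.
by near: n; exact: nbhs_infty_ger.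
Unshelve. all: by end_near. Qed.

Theorem corollary4p5 (R : realType) :
  ((fun n : nat => harmonic_number R (fib n) / (n%:R * ln (golden_ratio R)))
     @ \oo --> (1 : R)) /\
  ((fun n : nat => harmonic_number R (fib n)) =
     (fun n : nat => n%:R * ln (golden_ratio R)) +O_\oo (fun _ : nat => 1 : R)).
Proof.
have bound : \forall n \near \oo,
    `|harmonic_number R (fib n) - n%:R * ln (golden_ratio R)|
      <= 1 + 2 * ln (golden_ratio R).
  by exists 2%N => // n; exact: harmonic_number_fib_dist_le.
split; first exact: cvg_div_linear (ln_gt0 (golden_ratio_gt1 R)) bound.
apply/eqaddOP.
apply: filterS (nbhs_pinfty_ge (num_real (1 + 2 * ln (golden_ratio R)))) => k.
move=> Ck; apply: filterS bound => n /le_trans; apply.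
by rewrite normr1 mulr1.
Qed.
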